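(* Let $r\in\mathbb{Z}^+$, let $G_1$ be a finite graph, and let $G_2$ be a finite $3r$-regular graph. Suppose $G_2$ is 3-balanced. Then the lexicographic product $G_1\cdot G_2$ is 3-balanced.
   Context: A graph is 3-balanced if it admits a vertex coloring $\ell:V\to\mathbb{Z}_3$ such that every vertex has, in its open neighborhood, the same number of vertices of each of the three colors. The lexicographic product $G_1\cdot G_2$ has vertex set $V(G_1)\times V(G_2)$ with $(u,v)\sim(u',v')$ iff $uu'\in E(G_1)$, or $u=u'$ and $vv'\in E(G_2)$. *)

(* Defs.v *)
From HB Require Import structures.
From mathcomp Require Import all_boot all_order all_algebra.
Set Implicit Arguments.
Unset Strict Implicit.
Unset Printing Implicit Defensive.

Record sgraph := SGraph {
  vertex :> finType;
  adj : rel vertex;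
  adj_sym : symmetric adj;
  adj_irr : irreflexive adj }.

Definition open_nbhd (G : sgraph) (v : G) : {set G} := [set w | adj v w].

Definition regular (k : nat) (G : sgraph) : Prop :=
  forall v : G, #|open_nbhd v| = k.

Definition balanced_coloring (G : sgraph) (l : G -> 'Z_3) : Prop :=
  forall (v : G) (a b : 'Z_3),
    #|[set w in open_nbhd v | l w == a]| = #|[set w in open_nbhd v | l w == b]|.

Definition three_balanced (G : sgraph) : Prop :=
  exists l : G -> 'Z_3, balanced_coloring l.

Section LexProduct.
Variables G1 G2 : sgraph.

Definition lex_adj : rel (G1 * G2) := fun x y =>
  adj x.1 y.1 || (x.1 == y.1) && adj x.2 y.2.

Lemma lex_adj_sym : symmetric lex_adj.
Proof. by move=> x y; rewrite /lex_adj adj_sym eq_sym (adj_sym x.2). Qed.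

Lemma lex_adj_irr : irreflexive lex_adj.
Proof. by move=> x; rewrite /lex_adj !adj_irr andbF. Qed.

Definition lex_product : sgraph := SGraph lex_adj_sym lex_adj_irr.

End LexProduct.

(* Main.v *)
(** Color (u, v) by the color of v.  Counting edges of G2 by the color of one
    endpoint shows that all color classes of G2 have the same size; hence every
    fiber over a neighbor of u contributes equally to the three colors, and so
    does the fiber over u itself, because G2 is balanced. *)
Require Import Defs.
From mathcomp Require Import all_boot all_order all_algebra.

(** Double counting of adjacent pairs [(v, w)] with [w] in [A]: each such [w] has [k] neighbors. *)
Lemma sum_card_nbhd_regular (k : nat) (G : sgraph) (A : {set G}) :
  regular k G -> \sum_(v : G) #|open_nbhd v :&: A| = #|A| * k.
Proof.
move=> Greg.
transitivity (\sum_(v : G) \sum_(w in A | adj v w) 1).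
  apply: eq_bigr => v _; rewrite sum1_card.
  by apply: eq_card => w; rewrite !inE andbC.
rewrite (exchange_big_dep (mem A)) /=; last by move=> v w _ /andP[].
rewrite -sum_nat_const; apply: eq_bigr => w wA.
rewrite sum1_card -(Greg w); apply: eq_card => v.
by rewrite !inE unfold_in /= wA adj_sym.
Qed.

(** Summing the balance condition over all vertices equates the class sizes times [k], and [k > 0]
    cancels. *)
Lemma balanced_color_class_card {k : nat} {G : sgraph} {l : G -> 'Z_3} :
  0 < k -> regular k G -> balanced_coloring l ->
  forall a b, #|[set w | l w == a]| = #|[set w | l w == b]|.
Proof.
move=> k_gt0 Greg lbal a b; apply/eqP; rewrite -(eqn_pmul2r k_gt0); apply/eqP.
rewrite -!(@sum_card_nbhd_regular k) //; apply: eq_bigr => v _.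
by rewrite -!setIdE; exact: lbal.
Qed.

Lemma card_lex_nbhd_color {T : eqType} (G1 G2 : sgraph) (l : G2 -> T)
    (x : lex_product G1 G2) (a : T) :
  #|[set y in open_nbhd x | l y.2 == a]| =
    #|open_nbhd x.1| * #|[set w | l w == a]| +
    #|[set w in open_nbhd x.2 | l w == a]|.
Proof.
case: x => u v /=.
set N := [set w in open_nbhd v | l w == a].
set C := [set w | l w == a].
(* Split into neighbors in fibers over neighbors of [u] and neighbors in the fiber of [u] itself. *)
have -> : [set y in open_nbhd ((u, v) : lex_product G1 G2) | l y.2 == a] =
    setX (open_nbhd u) C :|: setX [set u] N.
  apply/setP => -[u' v']; rewrite !inE /= /lex_adj /= (eq_sym u).
  by rewrite andb_orl andbA.
(* The two parts are disjoint, as [u] is not adjacent to itself. *)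
rewrite cardsU !cardsX cards1 mul1n [X in _ - X](_ : _ = 0) ?subn0 //.
apply: eq_card0 => -[u' v']; rewrite !inE /=.
by case: (eqVneq u' u) => [->|]; rewrite ?adj_irr ?andbF.
Qed.

Theorem theorem6p9 (r : nat) (r_gt0 : 0 < r) (G1 G2 : sgraph)
    (G2_regular : regular (3 * r) G2) (G2_balanced : three_balanced G2) :
  three_balanced (lex_product G1 G2).
Proof.
case: G2_balanced => l lbal; exists (fun x => l x.2) => x a b.
have k_gt0 : 0 < 3 * r by rewrite muln_gt0.
rewrite !card_lex_nbhd_color (lbal x.2 a b).
by rewrite (balanced_color_class_card k_gt0 G2_regular lbal a b).
Qed.
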